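(* Let $(X,p,K)$ be a complete partial metric type space and let $T_1,T_2:X\to X$ be mappings satisfying $$p(T_1x,T_2y)\le k\,[p(T_1x,x)+p(y,T_2y)]\quad\text{for all }x,y\in X,$$ where $k\in[0,\alpha)$ is a constant, with $\alpha<\min\{1/2,1/K\}$. Then $T_1$ and $T_2$ have a unique common fixed point $x^*\in X$, and for any $x\in X$ the orbits $\{T_1^{2n+1}x:\ n\ge 1\}$ and $\{T_2^{2n+2}x:\ n\ge 1\}$ converge to the fixed point.
   Context: A partial metric type on a set $X$ is a function $p:X\times X\to[0,\infty)$ such that: (pm1) for all $x,y\in X$, $x=y$ iff $p(x,x)=p(x,y)=p(y,y)$; (pm2) $p(x,x)\le p(x,y)$ for all $x,y\in X$; (pm3) $p(x,y)=p(y,x)$ for all $x,y\in X$; (pm4) there is a real number $K\ge 1$ such that $p(x,y)+p(z_1,z_1)+\cdots+p(z_N,z_N)\le K[p(x,z_1)+p(z_1,z_2)+\cdots+p(z_N,y)]$ for any points $x,y,z_1,\dots,z_N\in X$, where $N\ge 1$ is a fixed natural number. The triplet $(X,p,K)$ is called a $K$-partial metric space ($K$-PMS), or partial metric type space. A sequence $(x_n)$ in $X$ converges to $x\in X$ if $\lim_{n\to\infty}p(x_n,x)=p(x,x)$. It is Cauchy if $\lim_{n,m\to\infty}p(x_n,x_m)$ exists and is finite. $(X,p,K)$ is complete if for every Cauchy sequence $(x_n)$ in $X$ there is $x\in X$ with $\lim_{n,m\to\infty}p(x_n,x_m)=\lim_{n\to\infty}p(x_n,x)=p(x,x)$.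
   Formalization: T_1^{2n+1}x and T_2^{2n+2}x are read as the terms x_{2n+1}=T_1x_{2n} and x_{2n+2}=T_2x_{2n+1} of the joint orbit from x_0=x, since iterates of T_1 alone need not converge to the fixed point when K>1; X is assumed nonempty. *)

(* Defs.v *)
From mathcomp Require Import all_boot all_order all_algebra.
From mathcomp Require Import all_classical all_reals all_analysis.

Set Implicit Arguments.
Unset Strict Implicit.
Unset Printing Implicit Defensive.

Import Order.TTheory GRing.Theory Num.Theory.
Import numFieldNormedType.Exports.

Local Open Scope classical_set_scope.
Local Open Scope ring_scope.

Section PartialMetricType.
Context {R : realType} {X : Type}.
Implicit Types (p : X -> X -> R) (u : nat -> X) (x y : X).

(* p x z_1 + p z_1 z_2 + ... + p z_N y, for s = [:: z_1; ...; z_N] *)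
Fixpoint polygon_length p x (s : seq X) y : R :=
  if s is z :: s' then p x z + polygon_length p z s' y else p x y.

Record partial_metric_type (N : nat) p (K : R) : Prop := PartialMetricType {
  pmt_N_ge1 : (1 <= N)%N;
  pmt_K_ge1 : 1 <= K;
  pmt_ge0 : forall x y, 0 <= p x y;
  pmt_eqP : forall x y, x = y <-> (p x x = p x y /\ p x y = p y y);
  pmt_self_le : forall x y, p x x <= p x y;
  pmt_sym : forall x y, p x y = p y x;
  pmt_polygon : forall x y (z : N.-tuple X),
    p x y + \sum_(w <- z) p w w <= K * polygon_length p x z y
}.

Definition pmt_cvg_to p u x : Prop := p (u n) x @[n --> \oo] --> p x x.

Definition pmt_double_cvg p u (l : R) : Prop :=
  p (u nm.1) (u nm.2) @[nm --> (\oo, \oo)] --> l.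

(* The limit l is a real number, hence finite. *)
Definition pmt_cauchy p u : Prop := exists l : R, pmt_double_cvg p u l.

Definition pmt_complete p : Prop :=
  forall u, pmt_cauchy p u ->
    exists x, pmt_double_cvg p u (p x x) /\ pmt_cvg_to p u x.

(* The joint orbit of the pair (T1, T2) starting at x:
     x_0 = x,  x_(2n+1) = T1 x_(2n),  x_(2n+2) = T2 x_(2n+1).
   In the theory of common fixed points of a pair of maps, "T1^(2n+1) x" and
   "T2^(2n+2) x" denote the terms x_(2n+1) and x_(2n+2) of this orbit.  They
   are not the iterates of T1 alone and of T2 alone: those need not converge
   to the common fixed point when K > 1. *)
Fixpoint joint_orbit (T1 T2 : X -> X) x (n : nat) : X :=
  if n is m.+1 then
    (if odd m then T2 else T1) (joint_orbit T1 T2 x m)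
  else x.

End PartialMetricType.

(* Main.v *)
Require Import Defs.
From mathcomp Require Import all_boot all_order all_algebra.
From mathcomp Require Import all_classical all_reals all_analysis.
From mathcomp Require Import lra.

(** Why the theorem holds.  Along the joint orbit x_0, x_1 = T1 x_0,
    x_2 = T2 x_1, ..., every step compares a value of T1 with a value of T2,
    so the contraction gives d_(n+1) <= k (d_n + d_(n+1)) for
    d_n = p x_n x_(n+1); as k < 1/2, the d_n decrease geometrically to 0
    ([orbit_gap_cvg0]).

    The Cauchy property needs no summation of the d_n along a path, which
    would be awkward because the factor K compounds.  If n and m have opposite
    parity, the contraction itself bounds p x_(n+1) x_(m+1) by k (d_n + d_m).
    If they have the same parity, one passes through x_(m+2), using the
    polygon inequality once; collapsing all N intermediate points to a single
    one turns it into the triangle inequality of [pmt_triangle].  Hence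
    p x_(n+1) x_(m+1) <= C (d_n + d_m) in all cases ([orbit_pair_le]), and the
    tail of the orbit has double limit 0.

    Completeness gives a limit s with p s s = 0.  In the triangle inequality
    between T2 s and s through x_(2n+1) = T1 x_(2n), letting n tend to infinity
    leaves p (T2 s) s <= K k p (T2 s) s, so p (T2 s) s = 0 as K k < 1: this is
    where the bound k < 1/K is used ([orbit_limit_fixed]).  The contraction at
    (s, s) then gives T1 s = s, and at two common fixed points it gives
    uniqueness; the limit therefore does not depend on the starting point. *)

Set Implicit Arguments.
Unset Strict Implicit.
Unset Printing Implicit Defensive.

Import Order.TTheory GRing.Theory Num.Theory.
Import numFieldNormedType.Exports.

Local Open Scope classical_set_scope.
Local Open Scope ring_scope.

Section CommonFixedPoint.
Context {R : realType} {X : Type} {N : nat} {p : X -> X -> R} {K : R}.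
Hypothesis hp : partial_metric_type N p K.

Lemma pmt_eq_of_le0 x y : p x y <= 0 -> x = y.
Proof.
move=> pxy_le0.
have pxy0 : p x y = 0 by apply/le_anti; rewrite pxy_le0 (pmt_ge0 hp).
have pxx0 : p x x = 0.
  by apply/le_anti; rewrite (pmt_ge0 hp) andbT -pxy0 (pmt_self_le hp).
have pyy0 : p y y = 0.
  apply/le_anti; rewrite (pmt_ge0 hp) andbT -pxy0 (pmt_sym hp x).
  exact: (pmt_self_le hp).
by apply/(pmt_eqP hp); rewrite pxx0 pxy0 pyy0.
Qed.

Lemma polygon_length_nseq x y z n :
  polygon_length p x (nseq n.+1 z) y = p x z + p z z *+ n + p z y.
Proof.
elim: n x => [|n IHn] x /=; first by rewrite mulr0n addr0.
by move: (IHn z) => /= ->; rewrite mulrS !addrA.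
Qed.

(** The polygon inequality with all N intermediate points equal to [z]: the
    N - 1 self-distances [p z z] that occur on the way are absorbed into
    [p z y]. *)
Lemma pmt_triangle x y z : p x y <= K * (p x z + p z y *+ N).
Proof.
have := pmt_polygon hp x y (nseq_tuple N z).
have K_ge0 : 0 <= K by apply: le_trans (pmt_K_ge1 hp).
have sum_ge0 : 0 <= \sum_(w <- nseq_tuple N z) p w w.
  by apply: sumr_ge0 => w _; exact: (pmt_ge0 hp).
move=> h; apply: le_trans (le_trans h _); first by rewrite lerDl.
rewrite ler_wpM2l //= -{1}(prednK (pmt_N_ge1 hp)) polygon_length_nseq.
rewrite -[X in p z y *+ X](prednK (pmt_N_ge1 hp)) mulrSr addrA lerD2r lerD2l.
by rewrite lerMn2r (pmt_self_le hp) orbT.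
Qed.

Context {T1 T2 : X -> X} {k : R}.
Hypotheses (k_ge0 : 0 <= k) (k_lt_half : k < 1 / 2) (Kk_lt1 : K * k < 1).
Hypothesis kannan :
  forall x y, p (T1 x) (T2 y) <= k * (p (T1 x) x + p y (T2 y)).

Let orbit := joint_orbit T1 T2.
Let gap x n := p (orbit x n) (orbit x n.+1).

Lemma orbit_opposite_parity_le x n m : odd n != odd m ->
  p (orbit x n.+1) (orbit x m.+1) <= k * (gap x n + gap x m).
Proof.
rewrite /gap /orbit /=.
case: (odd n) (odd m) => [] [] //= _.
  rewrite (pmt_sym hp (T2 _)) addrC (pmt_sym hp _ (T1 _)).
  exact: kannan.
by rewrite (pmt_sym hp _ (T1 _)); exact: kannan.
Qed.

Lemma orbit_gap_contract x n : gap x n.+1 <= (k / (1 - k)) * gap x n.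
Proof.
have k_lt1 : 0 < 1 - k by move: k_lt_half; lra.
have : gap x n.+1 <= k * (gap x n + gap x n.+1).
  by apply: orbit_opposite_parity_le; rewrite /=; case: (odd n).
rewrite mulrAC ler_pdivlMr //; lra.
Qed.

Lemma orbit_gapS_le x n : gap x n.+1 <= gap x n.
Proof.
have gap_ge0 : 0 <= gap x n by exact: (pmt_ge0 hp).
apply: le_trans (orbit_gap_contract x n) _.
apply: ler_piMl => //; rewrite ler_pdivrMr; move: k_lt_half; lra.
Qed.

Lemma orbit_gap_cvg0 x : gap x n @[n --> \oo] --> 0.
Proof.
have ratio_ge0 : 0 <= k / (1 - k).
  by rewrite divr_ge0 //; move: k_lt_half; lra.
have ratio_lt1 : `|k / (1 - k)| < 1.
  by rewrite ger0_norm // ltr_pdivrMr; move: k_lt_half; lra.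
apply: (@squeeze_cvgr _ _ _ _ (fun=> 0) (fun n => gap x 0 * (k / (1 - k)) ^+ n)).
- apply: nearW => n; rewrite (pmt_ge0 hp) /=.
  elim: n => [|n IHn]; first by rewrite expr0 mulr1.
  rewrite exprS mulrCA; apply: le_trans (orbit_gap_contract x n) _.
  exact: ler_wpM2l.
- exact: cvg_cst.
- by rewrite -[0](mulr0 (gap x 0)); apply: cvgMl_tmp; exact: cvg_expr.
Qed.

(** For n and m of the same parity the path goes through x_(m+2): its index has
    the parity opposite to that of n+1, so that the contraction controls the
    first leg, and the second leg is itself a gap, at most [gap x m]. *)
Lemma orbit_pair_le x n m :
  p (orbit x n.+1) (orbit x m.+1) <= K * N.+1%:R * (gap x n + gap x m).
Proof.
have K_ge1 := pmt_K_ge1 hp.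
have N1_ge1 : 1 <= N.+1%:R :> R by rewrite ler1n.
have gap_ge0 i : 0 <= gap x i by exact: (pmt_ge0 hp).
have sum_ge0 : 0 <= gap x n + gap x m by rewrite addr_ge0.
have [same|opp] := eqVneq (odd n) (odd m); last first.
  apply: le_trans (orbit_opposite_parity_le x opp) _.
  apply: ler_wpM2r => //; move: k_lt_half; nra.
apply: le_trans (pmt_triangle _ _ (orbit x m.+2)) _.
rewrite -mulrA ler_wpM2l //; first by lra.
have pn : p (orbit x n.+1) (orbit x m.+2) <= k * (gap x n + gap x m.+1).
  by apply: orbit_opposite_parity_le; rewrite same /=; case: (odd m).
have gm := orbit_gapS_le x m.
rewrite (pmt_sym hp _ (orbit x m.+1)) -/(gap x m.+1) -mulr_natl mulrSr.
have N_ge0 : 0 <= N%:R :> R by [].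
have Ngm : N%:R * gap x m.+1 <= N%:R * (gap x n + gap x m).
  by apply: ler_wpM2l => //; move: (gap_ge0 n); lra.
have kgm : k * (gap x n + gap x m.+1) <= 1 * (gap x n + gap x m).
  by apply: ler_pM => //; [rewrite addr_ge0|move: k_lt_half; lra|lra].
lra.
Qed.

Lemma orbit_tail_double_cvg0 x : pmt_double_cvg p (fun n => orbit x n.+1) 0.
Proof.
apply: (@squeeze_cvgr _ _ _ _ (fun=> 0)
  (fun nm : nat * nat => K * N.+1%:R * (gap x nm.1 + gap x nm.2))).
- by apply: nearW => nm; rewrite (pmt_ge0 hp) orbit_pair_le.
- exact: cvg_cst.
- have -> : 0 = K * N.+1%:R * (0 + 0) :> R by rewrite addr0 mulr0.
  apply: cvgMl_tmp; apply: cvgD.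
  + exact: (cvg_comp _ _ cvg_fst (orbit_gap_cvg0 x)).
  + exact: (cvg_comp _ _ cvg_snd (orbit_gap_cvg0 x)).
Qed.

Lemma common_fixed_unique x y :
  T1 x = x -> T2 x = x -> T1 y = y -> T2 y = y -> x = y.
Proof.
have self0 z : T1 z = z -> T2 z = z -> p z z = 0.
  move=> T1z T2z; have := kannan z z; rewrite T1z T2z.
  have := pmt_ge0 hp z z; move: k_lt_half; nra.
move=> T1x T2x T1y T2y; apply: pmt_eq_of_le0.
have := kannan x y; rewrite T1x T2y (self0 x) // (self0 y) //.
by rewrite addr0 mulr0.
Qed.

(** Only [T2 s = s] needs the orbit.  The passage is through the odd terms
    because they are values of [T1], so that the contraction bounds their
    distance to [T2 s] by k times a gap plus k times [p s (T2 s)]. *)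
Lemma orbit_limit_fixed x s : p s s = 0 ->
  p (orbit x n.+1) s @[n --> \oo] --> 0 -> T1 s = s /\ T2 s = s.
Proof.
move=> pss0 orbit_cvg.
have even_cvg : (2 * n)%N @[n --> \oo] --> \oo by exact: cvg_mulnl.
suff T2s : T2 s = s.
  split=> //; apply: pmt_eq_of_le0.
  have := kannan s s; rewrite T2s pss0.
  have := pmt_ge0 hp (T1 s) s; move: k_lt_half; nra.
apply: pmt_eq_of_le0.
pose bound n := K * (k * (gap x (2 * n) + p s (T2 s)) +
                     p (orbit x (2 * n).+1) s *+ N).
have bound_cvg : bound n @[n --> \oo] --> K * (k * (0 + p s (T2 s)) + 0 *+ N).
  apply: cvgMl_tmp; apply: cvgD.
    apply: cvgMl_tmp; apply: cvgD; last exact: cvg_cst.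
    exact: (cvg_comp _ _ even_cvg (orbit_gap_cvg0 x)).
  apply: cvgMn; exact: (cvg_comp _ _ even_cvg orbit_cvg).
have : p (T2 s) s <= K * (k * (0 + p s (T2 s)) + 0 *+ N).
  apply: (ler_cvg_to (cvg_cst _) bound_cvg); apply: nearW => n.
  apply: le_trans (pmt_triangle _ _ (orbit x (2 * n).+1)) _.
  apply: ler_wpM2l; first by apply: le_trans (pmt_K_ge1 hp).
  rewrite lerD2r (pmt_sym hp (T2 s)) /gap (pmt_sym hp (orbit x (2 * n))).
  rewrite /orbit /= oddM /=; exact: kannan.
rewrite add0r mul0rn addr0 mulrA (pmt_sym hp s).
have := pmt_ge0 hp (T2 s) s; move: Kk_lt1; nra.
Qed.

(** Completeness is applied to the orbit without its starting point, which is
    the only term that need not be a value of [T1] or [T2]. *)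
Lemma orbit_cvg_common_fixed (hcomplete : pmt_complete p) x :
  exists s, [/\ T1 s = s, T2 s = s & pmt_cvg_to p (fun n => orbit x n.+1) s].
Proof.
have tail0 := orbit_tail_double_cvg0 x.
have [s [tail_pss orbit_cvg]] := hcomplete _ (ex_intro _ _ tail0).
have pss0 : p s s = 0 by exact: (cvg_unique _ tail_pss tail0).
have cvg0 : p (orbit x n.+1) s @[n --> \oo] --> 0.
  by move: orbit_cvg; rewrite /pmt_cvg_to pss0.
by have [T1s T2s] := orbit_limit_fixed pss0 cvg0; exists s.
Qed.

End CommonFixedPoint.

Theorem theorem2p6 (R : realType) (X : Type) (N : nat) (p : X -> X -> R) (K : R)
  (hX : inhabited X)
  (hp : partial_metric_type N p K)
  (hcomplete : pmt_complete p)
  (T1 T2 : X -> X) (alpha k : R)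
  (halpha : alpha < Num.min (1 / 2) (1 / K))
  (hk : 0 <= k < alpha)
  (hT : forall x y : X, p (T1 x) (T2 y) <= k * (p (T1 x) x + p y (T2 y))) :
  exists xstar : X,
    [/\ T1 xstar = xstar /\ T2 xstar = xstar,
        forall y : X, T1 y = y /\ T2 y = y -> y = xstar
      & forall x : X,
          pmt_cvg_to p (fun n => joint_orbit T1 T2 x (2 * n + 1)) xstar /\
          pmt_cvg_to p (fun n => joint_orbit T1 T2 x (2 * n + 2)) xstar].
Proof.
have /andP[k_ge0 k_lt_alpha] := hk.
have K_ge1 := pmt_K_ge1 hp.
move: halpha; rewrite lt_min => /andP[alpha_half alpha_K].
have k_lt_half : k < 1 / 2 by exact: lt_trans alpha_half.
have Kk_lt1 : K * k < 1.
  by rewrite mulrC -ltr_pdivlMr; [exact: lt_trans alpha_K|lra].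
have orbit_cvg := orbit_cvg_common_fixed hp k_ge0 k_lt_half Kk_lt1 hT hcomplete.
have unique := common_fixed_unique hp k_lt_half hT.
case: hX => x0; have [s [T1s T2s _]] := orbit_cvg x0.
exists s; split=> // [y [T1y T2y]|x]; first exact: unique.
have [s' [T1s' T2s' cvg_s']] := orbit_cvg x.
have -> : s = s' by exact: unique.
have even_cvg : (2 * n)%N @[n --> \oo] --> \oo by exact: cvg_mulnl.
split.
- rewrite /pmt_cvg_to; under eq_fun do rewrite addn1.
  exact: (cvg_comp _ _ even_cvg cvg_s').
- rewrite /pmt_cvg_to; under eq_fun do rewrite addnS.
  exact: (cvg_comp _ _ (cvg_comp _ _ even_cvg (cvg_addnr 1)) cvg_s').
Qed.
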